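(* Let $\delta_n(\chi,S_c)=\max\{d_T(\chi(T),S_c(T)) : T \text{ a tree on } n \text{ vertices}\}$. Then $\lim_{n\to\infty}\frac{\delta_n(\chi,S_c)}{n}=\frac12$.
   Context: For subsets $U,V$ of vertices of a tree $T$, $d_T(U,V)=\min\{d(u,v):u\in U,v\in V\}$ with $d(u,v)$ the number of edges on the $u$–$v$ path. Subtree core: for $v\in V(T)$ let $f_T(v)$ be the number of subtrees of $T$ containing $v$; $S_c(T)$ is the set of vertices maximizing $f_T$. Characteristic set: let $L(T)=D(T)-A(T)$ be the Laplacian matrix, $\mu$ its second smallest eigenvalue and $Y$ an eigenvector for $\mu$ (Fiedler vector). A vertex $v$ is a characteristic vertex if $Y(v)=0$ and some neighbour $u$ has $Y(u)\neq0$; an edge $\{u,v\}$ is a characteristic edge if $Y(u)Y(v)<0$. The characteristic set $\chi(T)$ is the set of characteristic vertices and edges; for a tree it is a single vertex or a single edge, independent of $Y$. An edge is regarded as the set of its two endpoints when computing distances. *)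

(* Defs.v *)
From HB Require Import structures.
From mathcomp Require Import all_boot all_order all_algebra.
From mathcomp Require Import all_classical all_reals all_analysis.

Set Implicit Arguments.
Unset Strict Implicit.
Unset Printing Implicit Defensive.

Import Order.TTheory GRing.Theory Num.Theory.
Import numFieldNormedType.Exports.

Local Open Scope ring_scope.

Section Graphs.
Variable T : finType.
Implicit Types (V : {set T}) (E : {set {set T}}).

(* A graph is a pair of a vertex set V and a set E of edges, each edge being
   the set of its two endpoints. *)
Definition adj E : rel T := fun u v => [set u; v]%SET \in E.

Definition is_graph V E : Prop :=
  forall D : {set T}, D \in E -> #|D| = 2 /\ D \subset V.

Definition graph_connected V E : Prop :=
  forall u v, u \in V -> v \in V -> connect (adj E) u v.

Definition acyclic E : Prop :=
  forall c : seq T, ucycle (adj E) c -> (size c <= 2)%N.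

Definition is_tree V E : Prop :=
  [/\ V != finset.set0, is_graph V E, graph_connected V E & acyclic E].

Definition is_path E (u v : T) (p : seq T) : Prop :=
  [/\ path (adj E) u p, last u p = v & uniq (u :: p)].

(* [p] lists the vertices of the path other than [u], so its size is the number
   of edges. In a tree there is exactly one such [p]. *)
Definition dist E (u v : T) : nat := size (xget [::] (is_path E u v)).

(* Distances in a tree are < #|T|, so the seed #|T| is neutral: it is returned
   only when A or B is empty. *)
Definition dist_sets E (A B : {set T}) : nat :=
  \big[minn/#|T|]_(u in A) \big[minn/#|T|]_(v in B) dist E u v.

Definition subtrees E : {set {set T} * {set {set T}}} :=
  [set S : {set T} * {set {set T}} |
     (S.2 \subset E) && `[< is_tree S.1 S.2 >]]%SET.

Definition num_subtrees E (v : T) : nat :=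
  #|[set S in subtrees E | v \in S.1]%SET|.

Definition subtree_core E : {set T} :=
  [set v | [forall u, num_subtrees E u <= num_subtrees E v]%N]%SET.

End Graphs.

Section CharacteristicSet.
Variables (R : realType) (n : nat).
Implicit Types (E : {set {set 'I_n}}) (Y : 'cV[R]_n).

Definition degree E (u : 'I_n) : nat := #|[set v | adj E u v]%SET|.

Definition degree_mx E : 'M[R]_n := diag_mx (\row_u (degree E u)%:R).

Definition adjacency_mx E : 'M[R]_n := \matrix_(u, v) (adj E u v)%:R.

Definition laplacian E : 'M[R]_n := degree_mx E - adjacency_mx E.

(* Eigenvalues in nondecreasing order, with multiplicity. *)
Definition is_spectrum (M : 'M[R]_n) (s : seq R) : Prop :=
  sorted <=%R s /\ char_poly M = \prod_(a <- s) ('X - a%:P).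

(* The sequence is uniquely determined, and it exists as the Laplacian is
   symmetric; for n < 2 there is no second eigenvalue and the value is junk. *)
Definition second_eigenvalue E : R :=
  nth 0 (xget [::] (is_spectrum (laplacian E))) 1.

Definition is_fiedler E Y : Prop :=
  Y != 0 /\ laplacian E *m Y = second_eigenvalue E *: Y.

Definition char_vertices E Y : {set 'I_n} :=
  [set v | (Y v 0 == 0) && [exists u, adj E v u && (Y u 0 != 0)]]%SET.

Definition char_edges E Y : {set {set 'I_n}} :=
  [set D in E | [exists u, exists v,
     (D == [set u; v]%SET) && (Y u 0 * Y v 0 < 0)]]%SET.

Definition fiedler E : 'cV[R]_n := xget 0 (is_fiedler E).

(* The characteristic set, each characteristic edge being replaced by its two
   endpoints. For a tree it does not depend on the choice of Fiedler vector. *)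
Definition char_set E : {set 'I_n} :=
  char_vertices E (fiedler E) :|: finset.cover (char_edges E (fiedler E)).

End CharacteristicSet.

(* Every tree on n vertices is isomorphic to one with vertex set 'I_n. *)
Definition delta (R : realType) (n : nat) : nat :=
  \max_(E : {set {set 'I_n}} | `[< is_tree [set: 'I_n]%SET E >])
    dist_sets E (char_set R E) (subtree_core E).

(* Main.v *)
(** Let [Y] be a Fiedler vector with eigenvalue [mu], and [c] a characteristic
vertex. For any path of length [d] starting at [c] into a branch [B], one may
assume (changing the sign of [Y], or moving [c] one step along the path) that
[Y c >= 0] and that [Y] is negative on a nonempty set [N] of vertices outside
[B]. The restriction [Z] of [-Y] to [N] has Rayleigh quotient at most [mu].
Sorting the values of [Z] and transplanting them along the path, constant on
the subtrees hanging from it, does not increase the energy. If [d > #|N|] the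
largest value can be repeated, so the transplanted function [phi] has Rayleigh
quotient less than [mu]; a combination of [phi] and [Z] orthogonal to the
constants then contradicts the variational characterisation of [mu]. As
[#|N| + d + 1 <= n], all vertices are at distance at most [(n + 1) / 2] from all
characteristic vertices, which is the upper bound.

For the lower bound take a path with about [2 log n] leaves attached to one
end [a]. The subtree core lies within distance 1 of [a], because of the
[2 ^ k] substars at [a], while the characteristic set is within [(n + 1) / 2]
of the other end by the first part. *)

Require Import Defs.
From HB Require Import structures.
From mathcomp Require Import all_boot all_order all_algebra.
From mathcomp Require Import all_classical all_reals all_analysis.
From mathcomp Require Import zify ring lra spectral complex.

Set Implicit Arguments.
Unset Strict Implicit.
Unset Printing Implicit Defensive.

Import Order.TTheory GRing.Theory Num.Theory.
Import numFieldNormedType.Exports.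

Local Open Scope ring_scope.

(** * Trees and the two sides of an edge *)

Section Graphs.
Variable T : finType.
Implicit Types (E : {set {set T}}) (A : {set T}).

Lemma adj_sym E : symmetric (adj E).
Proof. by move=> u v; rewrite /adj finset.setUC. Qed.

Lemma adj_neq (V : {set T}) E u v : is_graph V E -> adj E u v -> u != v.
Proof.
by move=> gE /gE[+ _]; rewrite cards2; case: eqVneq.
Qed.

Lemma adj_in (V : {set T}) E u v : is_graph V E -> adj E u v -> (u \in V) && (v \in V).
Proof.
move=> gE /gE[_ /fintype.subsetP sV]; apply/andP.
by split; apply: sV; rewrite !inE eqxx ?orbT.
Qed.

Lemma connect_cut (e : rel T) (A : {pred T}) u v :
  connect e u v -> u \in A -> v \notin A ->
  exists x y, [/\ connect e u x, e x y, x \in A & y \notin A].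
Proof.
move=> /connectP[p + ->]; elim: p u => [|w p IH] u /=; first by move=> _ ->.
case/andP=> uw pw uA vA; have [wA|wA] := boolP (w \in A); last by exists u, w.
have [x [y [wx xy xA yA]]] := IH w pw wA vA.
by exists x, y; split => //; apply: connect_trans (connect1 uw) wx.
Qed.

Lemma acyclic_sub E E' : E' \subset E -> acyclic E -> acyclic E'.
Proof.
move=> /fintype.subsetP sE aE c /andP[cc uc]; apply: aE; rewrite /ucycle uc andbT.
by case: c cc {uc} => //= x c; apply: sub_path => u v /sE.
Qed.

(** A simple path from [u] to [v] avoiding the edge would close up with it to a cycle on at least
    three vertices. *)
Lemma acyclic_bridge E u v : acyclic E -> adj E u v -> u != v ->
  ~~ connect (adj (E :\ [set u; v]%SET)) u v.
Proof.
move=> aE uv nuv; apply/negP => /connectP[p0 pp0 ep0].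
move: ep0; case: (shortenP pp0) => p pp up _ lp.
have sE : subrel (adj (E :\ [set u; v]%SET)) (adj E) by move=> x y /setD1P[].
have pp' : path (adj E) u p := sub_path sE pp.
have cp : ucycle (adj E) (u :: p).
  by rewrite /ucycle up andbT /= rcons_path pp' -lp /= adj_sym.
have := aE _ cp; case: p pp lp {pp' cp up} => [|w [|w' p]] //=.
- by move=> _ vu; rewrite vu eqxx in nuv.
- by rewrite andbT => + vw; rewrite vw /adj !inE eqxx.
Qed.

(** For an edge of a tree this is the branch at [x] through [y], so the order of [x] and [y]
    matters. *)
Definition side E (x y : T) : {set T} :=
  [set v | connect (adj (E :\ [set x; y]%SET)) y v]%SET.

Lemma side_cut E x y u v : adj E u v -> u \in side E x y -> v \notin side E x y ->
  [set u; v]%SET = [set x; y]%SET.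
Proof.
move=> uv; rewrite !inE => yu; apply: contraNeq => ne.
by apply: connect_trans yu (connect1 _); rewrite /adj !inE ne.
Qed.

(** Only the deleted edge can leave the side; as it is a bridge, [x] lies outside, and this fixes
    the direction of the crossing. *)
Lemma side_cut_eq E x y u v : acyclic E -> adj E x y -> x != y ->
  adj E u v -> u \in side E x y -> v \notin side E x y -> u = y /\ v = x.
Proof.
move=> aE xy nxy uv uS vS.
have xS : x \notin side E x y.
  by rewrite inE (sym_connect_sym (adj_sym _)) acyclic_bridge.
have yS : y \in side E x y by rewrite inE connect0.
have e := side_cut uv uS vS.
have : u \in [set x; y]%SET by rewrite -e !inE eqxx.
have : v \in [set x; y]%SET by rewrite -e !inE eqxx orbT.
rewrite !inE => /orP[]/eqP ev /orP[]/eqP eu; subst => //.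
- by rewrite uS in xS.
- by rewrite uS in xS.
by rewrite uS in vS.
Qed.

(** * Branches along a path *)

Section PathSides.
Variables (E : {set {set T}}) (c : T) (p : seq T).
Hypothesis (aE : acyclic E) (pE : path (adj E) c p) (up : uniq (c :: p)).

Local Notation q i := (nth c (c :: p) i).

Lemma path_vertex_inj i j : (i <= size p)%N -> (j <= size p)%N -> q i = q j -> i = j.
Proof. by move=> li lj /eqP; rewrite nth_uniq// => /eqP. Qed.

Lemma path_edge i : (i < size p)%N -> adj E (q i) (q i.+1).
Proof. by move=> li; move/(pathP c): pE => /(_ i li). Qed.

Lemma path_vertex_neq i : (i < size p)%N -> q i != q i.+1.
Proof. clear aE pE; by move=> li; apply/eqP => /path_vertex_inj; lia. Qed.

Lemma path_edge_inj i k : (i < size p)%N -> (k < size p)%N ->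
  [set q k; q k.+1]%SET = [set q i; q i.+1]%SET -> k = i.
Proof.
clear aE pE.
move=> li lk e.
have : q k \in [set q i; q i.+1]%SET by rewrite -e !inE eqxx.
have : q k.+1 \in [set q i; q i.+1]%SET by rewrite -e !inE eqxx orbT.
rewrite !inE => /orP[]/eqP/path_vertex_inj e1 /orP[]/eqP/path_vertex_inj e2.
all: by move: e1 e2 => /(_ _ _)/wrap[]; lia.
Qed.

Lemma path_avoid i j k : (i < size p)%N -> (j <= k <= size p)%N ->
  (k <= i)%N || (i < j)%N ->
  connect (adj (E :\ [set q i; q i.+1]%SET)) (q j) (q k).
Proof.
move=> li /andP[jk lk] ijk; elim: k jk lk ijk => [|k IH] jk lk ijk.
  by have -> : j = 0%N by lia.
have [->//|jk'] := eqVneq j k.+1.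
apply: (connect_trans (IH _ _ _)); try lia.
apply: connect1; rewrite /adj !inE; have := path_edge (i := k); rewrite /adj => ->; last lia.
by rewrite andbT; apply/eqP => /path_edge_inj; lia.
Qed.

Lemma path_side i j : (i < size p)%N -> (j <= size p)%N ->
  (q j \in side E (q i) (q i.+1)) = (i < j)%N.
Proof.
move=> li lj; rewrite inE; case: ltnP => ij.
  by apply: path_avoid; lia.
apply/negbTE/negP => ce.
have := acyclic_bridge aE (path_edge li) (path_vertex_neq li).
rewrite (sym_connect_sym (adj_sym _)) (connect_trans ce)//.
by apply: path_avoid; lia.
Qed.

(** Leaving the larger branch means crossing the first edge to [q 0], which would then lie beyond
    edge [i], against [path_side]. *)
Lemma path_side_sub i : (i < size p)%N ->
  side E (q i) (q i.+1) \subset side E c (q 1).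
Proof.
move=> li; have d0 : (0 < size p)%N by lia.
have [->//|i0] := eqVneq i 0%N.
apply/fintype.subsetP => u; rewrite inE => cu; apply/negPn/negP => uF.
have qF : q i.+1 \in side E (q 0) (q 1) by rewrite path_side.
have [x [y [cx xy xF yF]]] := connect_cut cu qF uF.
have [_ ey] : x = q 1 /\ y = q 0.
  apply: side_cut_eq xF yF => //; [exact: path_edge|exact: path_vertex_neq|].
  by case/setD1P: xy.
have : q 0 \in side E (q i) (q i.+1).
  by rewrite inE -ey (connect_trans cx)// connect1.
by rewrite path_side.
Qed.

End PathSides.
End Graphs.

(** * Energy of functions on a tree *)

Section Energy.
Variables (R : realFieldType) (T : finType).
Implicit Types (E : {set {set T}}) (f : T -> R).

(* The sum runs over ordered pairs, so this is twice the quadratic form of the Laplacian. *)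
Definition energy E f : R := \sum_u \sum_v (adj E u v)%:R * (f u - f v) ^+ 2.

Definition exits (A : {set T}) (u v : T) : R := ((u \in A) && (v \notin A))%:R.

Lemma exitsE (A : {set T}) u v :
  ((u \in A)%:R - (v \in A)%:R) ^+ 2 = exits A u v + exits A v u :> R.
Proof. by rewrite /exits; case: (u \in A); case: (v \in A) => /=; ring. Qed.

Lemma sum_exits_sym E (A : {set T}) :
  \sum_u \sum_v (adj E u v)%:R * (exits A u v + exits A v u) =
  2 * \sum_u \sum_v (adj E u v)%:R * exits A u v.
Proof.
rewrite mulr_natl mulr2n [in X in _ = _ + X]exchange_big -big_split /=.
apply: eq_bigr => u _; rewrite -big_split /=; apply: eq_bigr => v _.
by rewrite mulrDr (adj_sym E v u).
Qed.

(** Writes an energy as a weighted sum over cuts, so that it remains to count the edges leaving each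
    [A i]: at least one in the rearrangement, at most one in the transplantation. *)
Lemma sum_mul_exits E (n : nat) (g : nat -> R) (A : nat -> {set T}) :
  \sum_u \sum_v (adj E u v)%:R *
    \sum_(i < n) g i * (exits (A i) u v + exits (A i) v u) =
  \sum_(i < n) g i * (2 * \sum_u \sum_v (adj E u v)%:R * exits (A i) u v).
Proof.
under [RHS]eq_bigr do rewrite -sum_exits_sym mulr_sumr.
rewrite [RHS]exchange_big /=; apply: eq_bigr => u _.
under [RHS]eq_bigr do rewrite mulr_sumr.
rewrite [RHS]exchange_big /=; apply: eq_bigr => v _.
by rewrite mulr_sumr; apply: eq_bigr => i _; ring.
Qed.

Lemma sum_exits_ge1 E (A : {set T}) x y : adj E x y -> x \in A -> y \notin A ->
  1 <= \sum_u \sum_v (adj E u v)%:R * exits A u v.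
Proof.
move=> xy xA yA; rewrite (bigD1 x)//= (bigD1 y)//= xy /exits xA yA mulr1 -addrA lerDl.
by rewrite addr_ge0// sumr_ge0// => i _; rewrite ?sumr_ge0// => *; rewrite mulr_ge0.
Qed.

Lemma sum_exits_le1 E (A : {set T}) x y :
  (forall u v, adj E u v -> u \in A -> v \notin A -> u = x /\ v = y) ->
  \sum_u \sum_v (adj E u v)%:R * exits A u v <= 1.
Proof.
move=> h; apply: (@le_trans _ _ (\sum_u \sum_v ((u == x) && (v == y))%:R)).
  apply: ler_sum => u _; apply: ler_sum => v _; rewrite /exits -natrM ler_nat mulnb.
  by case: and3P => // -[uv uA vA]; have [-> ->] := h u v uv uA vA; rewrite !eqxx.
rewrite (bigD1 x)//= [X in _ + X]big1 ?addr0; last first.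
  by move=> u /negbTE ->; rewrite big1.
rewrite (bigD1 y)//= big1 ?addr0 ?eqxx//.
by move=> u /negbTE ->.
Qed.

(** The gaps are nonnegative, so the cross terms in the square of their sum only increase it. *)
Lemma sqr_gap_sum (a : nat -> R) (b e : nat) : (b <= e)%N ->
  {in [pred i | b <= i <= e]%N &, {homo a : i j / (i <= j)%N >-> i <= j}} ->
  \sum_(b <= i < e) (a i.+1 - a i) ^+ 2 <= (a e - a b) ^+ 2.
Proof.
elim: e => [|e IH] be ha; first by rewrite big_geq// sqr_ge0.
have [->|be'] := eqVneq b e.+1; first by rewrite big_geq// sqr_ge0.
have {}be' : (b <= e)%N by lia.
rewrite big_nat_recr//=.
have h1 : a b <= a e by apply: ha; rewrite ?inE; lia.
have h2 : a e <= a e.+1 by apply: ha; rewrite ?inE; lia.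
have := IH be' _ => /(_ _)/wrap[].
  by move=> i j; rewrite !inE => hi hj; apply: ha; rewrite inE; lia.
by move=> h3; nra.
Qed.

(* Sorting the values of [f], every gap between consecutive values is bridged
   by some edge, and an edge bridging several gaps pays at least the sum of
   their squares. *)
Lemma energy_rearrangement E f (m := #|[set v | f v != 0]%SET|) :
  graph_connected [set: T]%SET E -> (forall v, 0 <= f v) -> (0 < m < #|T|)%N ->
  exists w : nat -> R,
    [/\ w 0%N = 0, w m != 0,
        \sum_(i < m) w i.+1 ^+ 2 = \sum_v f v ^+ 2 &
        2 * \sum_(i < m) (w i.+1 - w i) ^+ 2 <= energy E f].
Proof.
move=> cE f0 /andP[m0 mT].
have [x0 _] : exists x0 : T, true.
  by move: m0; rewrite card_gt0 => /set0Pn[x _]; exists x.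
pose s := sort (relpre f <=%R) (enum T).
have ms v : v \in s by rewrite mem_sort mem_enum.
have us : uniq s by rewrite sort_uniq enum_uniq.
have ss : size s = #|T| by rewrite size_sort -cardE.
pose n := #|T|; pose a i := f (nth x0 s i).
pose rk v := index v s.
have rkn v : (rk v < n)%N by rewrite /n -ss index_mem.
have ark v : a (rk v) = f v by rewrite /a nth_index.
have amono i j : (i <= j < n)%N -> a i <= a j.
  move=> ijn; have so : sorted (relpre f <=%R) s.
    by apply: sort_sorted => u v /=; apply: le_total.
  have tr : transitive (relpre f <=%R) by move=> u v t /=; apply: le_trans.
  have rr : reflexive (relpre f <=%R) by move=> u /=.
  by apply: (sorted_leq_nth tr rr x0 so); rewrite ?inE ?ss; lia.
have sumE (G : R -> R) : \sum_v G (f v) = \sum_(i < n) G (a i).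
  have -> : \sum_v G (f v) = \sum_(v <- s) G (f v).
    rewrite -[LHS](big_enum _ _ xpredT (fun v => G (f v))) /=.
    by apply: perm_big; rewrite perm_sym perm_sort.
  by rewrite (big_nth x0) ss big_mkord.
have mE : m%:R = \sum_(i < n) (a i != 0)%:R :> R.
  rewrite -(sumE (fun x => (x != 0)%:R)) /m cardsE -sum1_card natr_sum big_mkcond /=.
  by apply: eq_bigr => v _; rewrite unfold_in; case: (f v != 0).
(* Exactly [m] of the sorted values are nonzero; they occupy the indices after [k], and [w] starts
   at [k] with a zero. *)
pose k := (n.-1 - m)%N.
have kn : (k + m).+1 = n by rewrite /k /n; lia.
have ak : a k = 0.
  (* Otherwise the [m + 1] indices from [k] on would all carry nonzero values. *)
  apply: contraTeq isT => ak; exfalso.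
  have : \sum_(i < n) (k <= i)%N%:R <= m%:R :> R.
    rewrite mE; apply: ler_sum => i _; rewrite ler_nat; case: (boolP (k <= i)%N) => [ki|_]; last by [].
    have : a k <= a i by apply: amono; have := ltn_ord i; lia.
    have : 0 < a k by rewrite lt_neqAle eq_sym ak f0.
    by move=> h1 h2; rewrite (gt_eqF (lt_le_trans h1 h2)).
  rewrite -natr_sum ler_nat => h.
  move: h; rewrite -(big_mkord xpredT (fun i => (k <= i)%N : nat)) (@big_cat_nat _ _ _ k)//=; last lia.
  rewrite [X in (_ + X)%N](eq_big_nat _ _ (F2 := fun=> 1%N)); last by move=> i /andP[-> _].
  by rewrite sum_nat_const_nat; lia.
have a0 i : (i <= k)%N -> a i = 0.
  by move=> ik; apply/eqP; rewrite eq_le f0 andbT -ak amono//; lia.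
have amax : a n.-1 != 0.
  apply: contraTneq m0 => an; rewrite -leqNgt -(ler_nat R) mE big1// => i _.
  suff -> : a i = 0 by rewrite eqxx.
  by apply/eqP; rewrite eq_le f0 andbT -an amono//; have := ltn_ord i; lia.
pose g i := (a i.+1 - a i) ^+ 2.
exists (fun i => a (k + i)%N); split.
- by rewrite addn0.
- by have -> : (k + m = n.-1)%N by lia.
- rewrite (sumE (fun x => x ^+ 2)) -[RHS](big_mkord xpredT (fun i => a i ^+ 2)).
  rewrite (@big_cat_nat _ _ _ k.+1)//=; last lia.
  rewrite [X in _ = X + _]big_nat [X in _ = X + _]big1 ?add0r; last by move=> i ik; rewrite a0 ?expr0n//; lia.
  rewrite -{1}[k.+1]add0n big_addn big_mkord; have -> : (n - k.+1 = m)%N by lia.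
  by apply: eq_bigr => i _; congr (a _ ^+ 2); lia.
have -> : \sum_(i < m) (a (k + i.+1)%N - a (k + i)%N) ^+ 2 = \sum_(i < n.-1) g i.
  rewrite -[RHS](big_mkord xpredT g) (@big_cat_nat _ _ _ k)//=; last lia.
  rewrite [X in _ = X + _]big_nat [X in _ = X + _]big1 ?add0r; last first.
    by move=> i ik; rewrite /g !a0 ?subrr ?expr0n//; lia.
  rewrite -[in RHS](add0n k) big_addn big_mkord; have -> : (n.-1 - k = m)%N by lia.
  by apply: eq_bigr => i _; rewrite /g addnS addnC.
(* The cuts are the initial segments of the sorted order; by connectedness some edge leaves each of
   them. *)
pose A i := [set v | rk v <= i]%N%SET.
apply: (@le_trans _ _ (\sum_u \sum_v (adj E u v)%:R *
    \sum_(i < n.-1) g i * (exits (A i) u v + exits (A i) v u))).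
  rewrite sum_mul_exits mulr_sumr; apply: ler_sum => i _.
  rewrite mulrC ler_wpM2l ?sqr_ge0// ler_peMr//.
  have [u uE] : exists u, rk u = 0%N.
    by exists (nth x0 s 0); rewrite /rk index_uniq// ss; lia.
  have [v vE] : exists v, rk v = n.-1.
    by exists (nth x0 s n.-1); rewrite /rk index_uniq// ss; lia.
  have [] := @connect_cut _ _ (mem (A i)) _ _ (cE u v (finset.in_setT _) (finset.in_setT _)).
  - by rewrite inE uE.
  - by rewrite inE vE -ltnNge.
  by move=> x [y [_ xy xA yA]]; apply: sum_exits_ge1 xy xA yA.
(* A pair of vertices is separated exactly by the cuts between their ranks, whose squared gaps
   [sqr_gap_sum] controls. *)
have half u v : (rk u <= rk v)%N ->
    \sum_(i < n.-1) g i * (exits (A i) u v + exits (A i) v u) <= (f u - f v) ^+ 2.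
  move=> uv; rewrite -!ark -[X in _ <= X]sqrrN opprB.
  have := @sqr_gap_sum a _ _ uv _ => /(_ _)/wrap[].
    by move=> i j; rewrite !inE => _ hj ij; apply: amono; have := rkn v; lia.
  apply: le_trans.
  rewrite -(big_mkord xpredT (fun i => g i * (exits (A i) u v + exits (A i) v u))).
  have := rkn v => rv.
  rewrite (@big_cat_nat _ _ _ (rk u))//=; last lia.
  rewrite (@big_cat_nat _ _ _ (rk v) (rk u))//=; last lia.
  rewrite big_nat big1 ?add0r; last first.
    move=> i iu; rewrite /exits !inE.
    have -> : (rk u <= i)%N = false by lia.
    have -> : (rk v <= i)%N = false by lia.
    by rewrite /= addr0 mulr0.
  rewrite [X in _ + X]big_nat [X in _ + X]big1 ?addr0; last first.
    move=> i iu; rewrite /exits !inE.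
    have -> : (rk u <= i)%N by lia.
    have -> : (rk v <= i)%N by lia.
    by rewrite /= addr0 mulr0.
  apply: ler_sum_nat => i iu; rewrite /exits !inE.
  have -> : (rk u <= i)%N by lia.
  have -> : (rk v <= i)%N = false by lia.
  by rewrite /= addr0 mulr1.
apply: ler_sum => u _; apply: ler_sum => v _; rewrite ler_wpM2l//.
have [uv|vu] := leqP (rk u) (rk v); first exact: half.
rewrite -[X in _ <= X]sqrrN opprB; under eq_bigr do rewrite addrC.
by apply: half; lia.
Qed.

Lemma sqr_sum_sparse (n : nat) (x : 'I_n -> R) :
  (forall i j, x i != 0 -> x j != 0 -> i = j) ->
  (\sum_i x i) ^+ 2 = \sum_i x i ^+ 2.
Proof.
move=> h; have [/forallP h0|] := boolP [forall i, x i == 0].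
  by rewrite !big1 ?expr0n// => i _; rewrite (eqP (h0 i)) ?expr0n.
rewrite negb_forall => /existsP[i xi].
by rewrite (bigD1 i)// [in RHS](bigD1 i)//= !big1 ?addr0// => j /eqP ji;
  have [->|/h/(_ xi)] := eqVneq (x j) 0; rewrite ?expr0n.
Qed.

(** [phi] adds the increment [w i.+1 - w i] on everything beyond the path edge [i]. It thus takes
    the values of [w] along the path and is constant on the hanging subtrees, so only path edges
    carry energy. *)
Lemma path_transplant (V : {set T}) E c p (w : nat -> R) :
  is_graph V E -> acyclic E -> path (adj E) c p -> uniq (c :: p) -> w 0%N = 0 ->
  exists phi : T -> R,
    [/\ forall u, u \notin side E c (nth c (c :: p) 1) -> phi u = 0,
        \sum_(i < size p) w i.+1 ^+ 2 <= \sum_u phi u ^+ 2 &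
        energy E phi <= 2 * \sum_(i < size p) (w i.+1 - w i) ^+ 2].
Proof.
move=> gE aE pE up w0; pose q i := nth c (c :: p) i.
pose F i := side E (q i) (q i.+1).
pose g i := w i.+1 - w i.
have F_sub i : (i < size p)%N -> F i \subset side E c (q 1).
  exact: path_side_sub.
exists (fun u => \sum_(i < size p) g i * (u \in F i)%:R); split.
- move=> u uF; rewrite big1// => i _.
  have /negbTE -> : u \notin F i by apply: contra uF; apply/fintype.subsetP/F_sub.
  by rewrite mulr0.
- have inj : injective (fun i : 'I_(size p) => q i.+1).
    by move=> i j /(path_vertex_inj up (ltn_ord i) (ltn_ord j))[] /val_inj.
  (* Only the path vertices other than [c] are kept; there the increments telescope to [w]. *)
  apply: (@le_trans _ _ (\sum_(u in [set q i.+1 | i : 'I_(size p)]%SET)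
      (\sum_(i < size p) g i * (u \in F i)%:R) ^+ 2)); last first.
    rewrite [leRHS](bigID [pred u | u \in [set q i.+1 | i : 'I_(size p)]%SET]) /= lerDl.
    by apply: sumr_ge0 => *; apply: sqr_ge0.
  rewrite big_imset /=; last by move=> i j _ _; apply: inj.
  apply: ler_sum => j _; rewrite le_eqVlt; apply/orP; left; apply/eqP; congr (_ ^+ 2).
  under eq_bigr => i _ do rewrite (path_side aE pE up (ltn_ord i) (ltn_ord j)).
  rewrite -(big_mkord xpredT (fun i => g i * (i < j.+1)%N%:R)).
  have jl := ltn_ord j.
  rewrite (@big_cat_nat _ _ _ j.+1)//=.
  rewrite [X in _ = _ + X]big_nat [X in _ = _ + X]big1 ?addr0; last first.
    by move=> i ij; rewrite (_ : (i < j.+1)%N = false) ?mulr0//; lia.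
  rewrite (eq_big_nat _ _ (F2 := g)); last first.
    by move=> i /andP[_ ->]; rewrite mulr1.
  by rewrite telescope_sumr// w0 subr0.
have ne i : (i < size p)%N -> q i != q i.+1 by move=> ?; apply: (path_vertex_neq up).
have pe i : (i < size p)%N -> adj E (q i) (q i.+1) by move=> ?; apply: (path_edge pE).
have -> : energy E (fun u => \sum_(i < size p) g i * (u \in F i)%:R) =
  \sum_u \sum_v (adj E u v)%:R *
    \sum_(i < size p) g i ^+ 2 * (exits (F i) u v + exits (F i) v u).
  apply: eq_bigr => u _; apply: eq_bigr => v _.
  case uv : (adj E u v); rewrite ?mul0r// !mul1r -sumrB.
  under eq_bigr do rewrite -mulrBr.
  rewrite sqr_sum_sparse; first by apply: eq_bigr => i _; rewrite exprMn exitsE.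
  (* A nonzero term forces the edge to be the path edge [i], so at most one term survives and the
     sum can be squared termwise. *)
  have ed (i : 'I_(size p)) : g i * ((u \in F i)%:R - (v \in F i)%:R) != 0 ->
      [set u; v]%SET = [set q i; q i.+1]%SET.
    case: (boolP (u \in F i)) => uF; case: (boolP (v \in F i)) => vF;
      rewrite ?subrr ?mulr0 ?eqxx// => _; first exact: side_cut uv uF vF.
    by rewrite finset.setUC; apply: side_cut vF uF; rewrite adj_sym.
  move=> i j /ed ei /ed ej; apply/val_inj; rewrite ei in ej.
  exact: (path_edge_inj up (ltn_ord j) (ltn_ord i) ej).
rewrite (sum_mul_exits E (size p) (fun i => g i ^+ 2) F) mulr_sumr.
apply: ler_sum => i _; rewrite mulrCA ler_wpM2l// ler_piMr ?sqr_ge0//.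
apply: (@sum_exits_le1 _ _ (q i.+1) (q i)) => u v uv uF vF.
by apply: side_cut_eq uv uF vF => //; [exact: pe|exact: ne].
Qed.

End Energy.

(** * Eccentricity of a characteristic vertex *)

Section TruncatedSums.
Variables (R : realFieldType) (w : nat -> R) (m d : nat).
Hypothesis md : (m < d)%N.

Lemma big_ord_split_at (G : nat -> R) : \sum_(i < d) G i =
  \sum_(i < m) G i + G m + \sum_(m.+1 <= i < d) G i.
Proof.
rewrite -[LHS](big_mkord xpredT) (@big_cat_nat _ _ _ m)//=; last exact: ltnW.
by rewrite big_mkord -addrA; congr (_ + _); rewrite big_ltn.
Qed.

(** Repeating the last value [w m] adds only zero gaps. *)
Lemma sum_gap_minn :
  \sum_(i < d) (w (minn i.+1 m) - w (minn i m)) ^+ 2 =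
  \sum_(i < m) (w i.+1 - w i) ^+ 2.
Proof.
rewrite (big_ord_split_at (fun i => (w (minn i.+1 m) - w (minn i m)) ^+ 2)).
rewrite [X in _ + X]big_nat [X in _ + X]big1 => [|i /andP[mi _]]; last first.
  by rewrite (minn_idPr (ltnW mi)) (minn_idPr (leqW (ltnW mi))) subrr expr0n.
rewrite (minn_idPr (leqnSn m)) minnn subrr expr0n !addr0.
by apply: eq_bigr => i _; rewrite (minn_idPl (ltn_ord i)) (minn_idPl (ltnW (ltn_ord i))).
Qed.

(** As [m < d], the nonzero value [w m] occurs at least once more than on the left. *)
Lemma sum_sqr_minn_gt : w m != 0 ->
  \sum_(i < m) w i.+1 ^+ 2 < \sum_(i < d) w (minn i.+1 m) ^+ 2.
Proof.
move=> wm; rewrite (big_ord_split_at (fun i => w (minn i.+1 m) ^+ 2)).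
have -> : \sum_(i < m) w (minn i.+1 m) ^+ 2 = \sum_(i < m) w i.+1 ^+ 2.
  by apply: eq_bigr => i _; rewrite (minn_idPl (ltn_ord i)).
rewrite -addrA ltrDl (minn_idPr (leqnSn m)) ltr_pwDl ?exprn_even_gt0//.
by apply: sumr_ge0 => i _; apply: sqr_ge0.
Qed.

End TruncatedSums.

Section Eccentricity.
Variables (R : realFieldType) (T : finType) (E : {set {set T}}).
Implicit Types (f Y : T -> R).

Definition lap f u : R := \sum_v (adj E u v)%:R * (f u - f v).

(** Summation by parts: exchanging [u] and [v] in one of two copies of the right-hand sum produces
    the squares. *)
Lemma energy_lap f : energy E f = 2 * \sum_u f u * lap f u.
Proof.
rewrite mulr_natl mulr2n; under [X in _ = X + _]eq_bigr do rewrite mulr_sumr.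
under [X in _ = _ + X]eq_bigr do rewrite mulr_sumr.
rewrite [X in _ = _ + X]exchange_big -big_split; apply: eq_bigr => u _ /=.
rewrite -big_split; apply: eq_bigr => v _ /=.
by rewrite (adj_sym E v u); ring.
Qed.

Lemma lapN f u : lap (fun v => - f v) u = - lap f u.
Proof. by rewrite -sumrN; apply: eq_bigr => v _; ring. Qed.

Hypothesis tE : is_tree [set: T]%SET E.
Variable mu : R.
Hypothesis mu_gt0 : 0 < mu.
Hypothesis rayleigh : forall f, \sum_u f u = 0 -> 2 * mu * (\sum_u f u ^+ 2) <= energy E f.

(** The set [N] of negative vertices outside the branch is disjoint from the path; a path with more
    than [#|N|] edges would yield a test function violating [rayleigh]. *)
Lemma branch_size Y c p : (forall u, lap Y u = mu * Y u) ->
  path (adj E) c p -> uniq (c :: p) -> 0 <= Y c ->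
  (exists2 x, x \notin side E c (nth c (c :: p) 1) & Y x < 0) ->
  (2 * size p < #|T|)%N.
Proof.
move=> LY pE up Yc [x xB Yx]; case: tE => _ gE cE aE.
(* For an empty path [nth] returns its default [c], so this case is settled apart. *)
have [p0|p0] := posnP (size p).
  by rewrite p0 muln0; apply/card_gt0P; exists x.
set B := side E c _ in xB; pose q i := nth c (c :: p) i.
pose N := [set u | (u \notin B) && (Y u < 0)]%SET.
have qB j : (j <= size p)%N -> (q j \in B) = (0 < j)%N by move=> jp; apply: path_side.
have cB : c \notin B by rewrite -[c]/(q 0%N) qB.
have exitB u v : adj E u v -> u \in B -> v \notin B -> v = c.
  move=> uv uB vB; apply: (proj2 (side_cut_eq aE _ _ uv uB vB)).
    exact: (path_edge pE p0).
  exact: (path_vertex_neq up p0).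
have inN u : (u \in N) = (u \notin B) && (Y u < 0) by rewrite inE.
have cN : c \notin N by rewrite inN negb_and -leNgt Yc orbT.
have xN : x \in N by rewrite inN xB.
pose m := #|N|.
(* The path vertices after [c] lie in [B], and [Y c >= 0], so [N] misses all [(size p).+1] of
   them. *)
have md : (m + (size p).+1 <= #|T|)%N.
  pose S := [set u in c :: p]%SET.
  have -> : (size p).+1 = #|S| by rewrite cardsE; move/card_uniqP: up => ->.
  have dNS : [disjoint N & S].
    rewrite disjoint_sym disjoint_subset; apply/fintype.subsetP => u uS; rewrite inE /= inN; rewrite inE in uS.
    have [j jp ->] : exists2 j, (j <= size p)%N & u = q j.
      by exists (index u (c :: p)); rewrite ?/q ?nth_index// -ltnS -[ltnRHS]/(size (c :: p)) index_mem.
    case: j jp => [|j] jp; first by rewrite negb_and -leNgt Yc orbT.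
    by rewrite qB.
  rewrite -(cardsUI) (_ : N :&: S = finset.set0) ?cards0 ?addn0 ?max_card//.
  by apply/eqP; rewrite setI_eq0.
suff: (size p <= m)%N by move: md; clear; lia.
rewrite leqNgt; apply/negP => mp.
pose Z u : R := if u \in N then - Y u else 0.
have Z0 u : 0 <= Z u.
  by rewrite /Z; case: ifP => //; rewrite inN => /andP[_ /ltW]; rewrite oppr_ge0.
have ZN : [set v | Z v != 0]%SET = N.
  apply/setP => v; rewrite inE /Z; case: ifP => [|_]; last by rewrite eqxx.
  by rewrite inN => /andP[_ Yv]; rewrite oppr_eq0 lt_eqF.
have m0 : (0 < m)%N by apply/card_gt0P; exists x.
have [w [w0 wm wZ wE]] : exists w : nat -> R,
    [/\ w 0%N = 0, w m != 0,
        \sum_(i < m) w i.+1 ^+ 2 = \sum_v Z v ^+ 2 &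
        2 * \sum_(i < m) (w i.+1 - w i) ^+ 2 <= energy E Z].
  have := @energy_rearrangement R T E Z cE Z0; rewrite ZN; apply.
  by rewrite m0 /=; apply: leq_trans md; rewrite addnS ltnS leq_addr.
pose w' i := w (minn i m).
have w'0 : w' 0%N = 0 by rewrite /w' min0n.
have [phi [phiB phiS phiE]] := path_transplant gE aE pE up w'0.
have gap : \sum_(i < size p) (w' i.+1 - w' i) ^+ 2 = \sum_(i < m) (w i.+1 - w i) ^+ 2.
  exact: sum_gap_minn.
have norm : \sum_v Z v ^+ 2 < \sum_u phi u ^+ 2.
  by apply: lt_le_trans phiS; rewrite -wZ; apply: sum_sqr_minn_gt.
(* At a vertex of [N], cutting [- Y] off to zero can only lower its Laplacian: neighbours outside
   [N] have [Y >= 0], since a neighbour in [B] would force the vertex to be [c]. *)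
have EZ : energy E Z <= 2 * mu * \sum_v Z v ^+ 2.
  rewrite energy_lap -mulrA ler_wpM2l// mulr_sumr; apply: ler_sum => u _.
  rewrite expr2 mulrCA; have [uN|uN] := boolP (u \in N); last first.
    by rewrite [Z u]/Z (negbTE uN) !mul0r.
  have Zu : Z u = - Y u by rewrite /Z uN.
  have Yu : Y u < 0 by move: uN; rewrite inN => /andP[].
  rewrite ler_wpM2l// Zu mulrN -LY -lapN /lap; apply: ler_sum => v _.
  case uv : (adj E u v); rewrite ?mul0r// !mul1r Zu lerD2l lerN2 /Z.
  case: ifP => // /negbT; rewrite inN negb_and negbK -leNgt oppr_le0 => /orP[vB|//].
  have uc : u = c.
    by apply: exitB vB _; [rewrite adj_sym|move: uN; rewrite inN => /andP[]].
  by rewrite uc ltNge Yc in Yu.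
have SZ : 0 < \sum_u Z u.
  rewrite (bigD1 x)//= ltr_pwDl ?sumr_ge0// {1}/Z xN oppr_gt0//.
(* This coefficient makes [W] orthogonal to the constants. *)
pose a := (\sum_u phi u) / \sum_u Z u.
pose W u := phi u - a * Z u.
have prod0 u : phi u * Z u = 0.
  have [uB|uB] := boolP (u \in B); last by rewrite phiB// mul0r.
  by rewrite /Z inN uB mulr0.
have W2 : \sum_u W u ^+ 2 = \sum_u phi u ^+ 2 + a ^+ 2 * \sum_u Z u ^+ 2.
  rewrite mulr_sumr -big_split; apply: eq_bigr => u _ /=.
  by have h := prod0 u; rewrite /W; ring: h.
have WE : energy E W = energy E phi + a ^+ 2 * energy E Z.
  rewrite /energy mulr_sumr -big_split; apply: eq_bigr => u _ /=.
  rewrite mulr_sumr -big_split; apply: eq_bigr => v _ /=.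
  case uv : (adj E u v); last by rewrite !mul0r mulr0 addr0.
  (* [phi] lives in [B] and [Z] outside; the one edge between the two parts ends at [c], where [Z]
     vanishes as well. *)
  have h : (phi u - phi v) * (Z u - Z v) = 0.
    have Zc : Z c = 0 by rewrite /Z (negbTE cN).
    have ZB t : t \in B -> Z t = 0 by move=> tB; rewrite /Z inN tB.
    have [uB|uB] := boolP (u \in B); have [vB|vB] := boolP (v \in B).
    - by rewrite !ZB// subrr mulr0.
    - by rewrite (ZB u)// (exitB u v uv uB vB) Zc subrr mulr0.
    - by rewrite (ZB v)// (exitB v u _ vB uB) ?Zc ?subrr ?mulr0// adj_sym.
    - by rewrite !phiB// subrr mul0r.
  have -> : W u - W v = (phi u - phi v) - a * (Z u - Z v) by rewrite /W; ring.
  have -> : ((phi u - phi v) - a * (Z u - Z v)) ^+ 2 = (phi u - phi v) ^+ 2 +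
      a ^+ 2 * (Z u - Z v) ^+ 2 - 2 * a * ((phi u - phi v) * (Z u - Z v)) by ring.
  by rewrite h mulr0 subr0 !mul1r.
have W0 : \sum_u W u = 0.
  by rewrite sumrB -mulr_sumr /a divfK ?subrr// gt_eqF.
(* The energy of [W] is at most [(1 + a ^+ 2)] times that of [Z], hence at most
   [2 * mu * (1 + a ^+ 2)] times the square norm of [Z], while the square norm of [W] is strictly
   more than [(1 + a ^+ 2)] times that of [Z]. *)
have := rayleigh W0; rewrite W2 WE; move: phiE; rewrite gap => phiE rW.
have h1 : a ^+ 2 * energy E Z <= a ^+ 2 * (2 * mu * \sum_v Z v ^+ 2).
  by rewrite ler_wpM2l// sqr_ge0.
have h2 : mu * \sum_v Z v ^+ 2 < mu * \sum_u phi u ^+ 2 by rewrite ltr_pM2l.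
move: wE phiE rW EZ h1 h2; clear.
move: (energy E Z) (energy E phi) (\sum_v Z v ^+ 2) (\sum_v phi v ^+ 2).
move: (\sum_(i < m) _) (a ^+ 2) => r1 r2 r3 r4 r5 r6; lra.
Qed.

(** Reduces to [branch_size] after a possible change of sign. The extra 1 in the bound pays for a
    path whose first step crosses the characteristic edge. *)
Lemma char_eccentricity Y c p : (forall u, lap Y u = mu * Y u) ->
  path (adj E) c p -> uniq (c :: p) ->
  (Y c = 0 /\ exists2 x, adj E c x & Y x != 0) \/
  (exists2 x, adj E c x & Y c * Y x < 0) ->
  (2 * size p <= #|T|.+1)%N.
Proof.
move=> LY pE up hc; case: (tE) => _ gE _ aE.
have LN u : lap (fun v => - Y v) u = mu * - Y u by rewrite lapN LY mulrN.
case: p pE up => [|d p] pE up; first by rewrite muln0.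
have exitB v : adj E c v -> v != d -> v \notin side E c d.
  move=> cv; apply: contra => vB; apply/eqP.
  have cB : c \notin side E c d by have := path_side aE pE up (ltn0Sn _) (leq0n _) => /= ->.
  rewrite adj_sym in cv; apply: (proj1 (side_cut_eq aE _ _ cv vB cB)).
    by case/andP: pE.
  by apply: (adj_neq gE); case/andP: pE.
case: hc => [[Yc [x cx Yx]]|[x cx Yx]].
  (* The eigenvalue equation at [c] makes the neighbouring values sum to zero, so a nonzero value at
     [d] is balanced by another neighbour. *)
  have [v cv [vd Yv]] : exists2 v, adj E c v & v != d /\ Y v != 0.
    have [xd|xd] := eqVneq x d; last by exists x.
    have [/existsP[v /and3P[cv vd Yv]]|] := boolP [exists v, [&& adj E c v, v != d & Y v != 0]].
      by exists v.
    rewrite negb_exists => /forallP h; have := LY c; rewrite Yc mulr0 /lap (bigD1 d)//= big1.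
      by rewrite -xd cx Yc mul1r sub0r addr0 => /eqP; rewrite oppr_eq0 (negbTE Yx).
    move=> v vd; have := h v; rewrite vd; case: (adj E c v) => /=; last by rewrite mul0r.
    by rewrite negbK => /eqP ->; rewrite Yc subrr mulr0.
  apply: ltnW; apply: leqW; case: (ltrgtP (Y v) 0) Yv => // Yv _.
    by apply: (branch_size LY pE up); rewrite ?Yc//; exists v => //; apply: exitB.
  apply: (branch_size LN pE up); rewrite ?Yc ?oppr0//.
  by exists v; rewrite ?oppr_lt0//; apply: exitB.
wlog Yc : Y LY LN Yx / 0 < Y c => [hw|].
  case: (ltrgtP (Y c) 0) => Yc; last by rewrite Yc mul0r ltxx in Yx.
    apply: (hw (fun v => - Y v) LN); rewrite ?mulrNN ?oppr_gt0// => u.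
    by rewrite [LHS]lapN LN [RHS]mulrN.
  exact: hw Yc.
have {}Yx : Y x < 0 by move: Yx; rewrite pmulr_rlt0.
have [xd|xd] := eqVneq x d; last first.
  apply: ltnW; apply: leqW; apply: (branch_size LY pE up); first exact: ltW.
  by exists x => //; apply: exitB.
(* The path crosses the characteristic edge: start again from [x] with [- Y], for which [c] is a
   negative vertex outside the branch. *)
subst d; case: p pE up {exitB} => [|e p] pE up.
  have : (0 < #|T|)%N by apply/card_gt0P; exists x.
  by rewrite /=; lia.
suff : (2 * size (e :: p) < #|T|)%N by rewrite /=; lia.
apply: (branch_size LN (c := x)).
- by case/andP: pE.
- by case/andP: up.
- by rewrite oppr_ge0 ltW.
exists c; last by rewrite oppr_lt0.
by have := path_side aE pE up (isT : 1 < size [:: x, e & p])%N (leq0n _) => /= ->.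
Qed.

End Eccentricity.

(** * Spectrum of the Laplacian *)

(** Take determinants in the intertwining relation between the characteristic matrices and cancel
    that of [P]. *)
Lemma char_poly_similar (F : fieldType) n (P A B : 'M[F]_n) :
  P \in unitmx -> P *m A = B *m P -> char_poly A = char_poly B.
Proof.
move=> uP PA; pose Q := map_mx polyC P.
have : Q *m char_poly_mx A = char_poly_mx B *m Q.
  rewrite /char_poly_mx mulmxBr mulmxBl scalar_mxC.
  by rewrite -!map_mxM PA.
move=> /(congr1 determinant); rewrite !det_mulmx mulrC; apply: mulIf.
by rewrite det_map_mx polyC_eq0 -unitfE -unitmxE.
Qed.

(** * Diagonalisation of real symmetric matrices *)

Section RealSymmetric.
Variables (R : rcfType) (n : nat) (M : 'M[R]_n).
Hypothesis symM : M^T = M.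

Local Notation "x %:C" := (real_complex R x).
Local Notation C := (R[i])%C.

(** [M] is diagonalised as a complex hermitian matrix: the rows of [P] are complex orthonormal
    eigenvectors, but the eigenvalues [d] are real. *)
Lemma symmetric_spectral : exists (P : 'M[C]_n) (d : 'I_n -> R),
  [/\ forall i j, \sum_k P i k * (P j k)^* = (i == j)%:R,
      forall k l, \sum_i (P i k)^* * P i l = (k == l)%:R,
      forall i l, \sum_k P i k * (M k l)%:C = (d i)%:C * P i l &
      char_poly M = \prod_i ('X - (d i)%:P)].
Proof.
pose A := map_mx (real_complex R) M.
have hA : A \is hermsymmx.
  apply: realsym_hermsym.
    by apply/is_hermitianmxP; rewrite expr0 scale1r map_mx_id//; apply/matrixP => i j; rewrite !mxE -[in LHS]symM mxE.
  by apply/mxOverP => i j; rewrite mxE; apply/complex_realP; exists (M i j).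
pose P := spectralmx A; pose sp := spectral_diag A.
have uP : P \in unitmx by exact: spectral_unit.
have oP : P *m (map_mx Num.conj P^T) = 1%:M by apply/unitarymxP/spectral_unitarymx.
have eA : A = invmx P *m diag_mx sp *m P by apply/orthomx_spectralP/hermitian_normalmx.
have PA : P *m A = diag_mx sp *m P by rewrite [in LHS]eA !mulmxA mulmxV// mul1mx.
pose d i := complex.Re (sp 0 i).
have spd i : sp 0 i = (d i)%:C.
  by rewrite RRe_real//; apply/mxOverP/hermitian_spectral_diag_real.
exists P, d; split.
- move=> i j; move/matrixP/(_ i j): oP; rewrite !mxE => <-.
  by apply: eq_bigr => k _; rewrite !mxE.
- move=> k l; move/mulmx1C/matrixP/(_ k l): oP; rewrite !mxE => <-.
  by apply: eq_bigr => i _; rewrite !mxE.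
- move=> i l; move/matrixP/(_ i l): PA; rewrite mul_diag_mx !mxE spd => <-.
  by apply: eq_bigr => k _; rewrite !mxE.
apply: (map_poly_inj (real_complex R)).
rewrite map_char_poly -/A (char_poly_similar uP PA) char_poly_trig ?diag_mx_is_trig//.
rewrite rmorph_prod; apply: eq_bigr => i _ /=.
by rewrite mxE eqxx mulr1n spd rmorphB /= map_polyX map_polyC.
Qed.

End RealSymmetric.

Section LaplacianSpectrum.
Variables (R : realType) (n : nat) (E : {set {set 'I_n}}).
Local Notation L := (laplacian R E).
Local Notation mu := (second_eigenvalue R E).

Lemma laplacian_sym : L^T = L.
Proof.
apply/matrixP => u v; rewrite !mxE eq_sym (adj_sym E v u).
by case: eqVneq => [->|].
Qed.

Lemma laplacianE (Y : 'cV[R]_n) u :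
  (L *m Y) u 0 = lap E (fun v => Y v 0) u.
Proof.
rewrite /lap; under eq_bigr do rewrite mulrBr; rewrite sumrB -mulr_suml.
rewrite mulmxBl mul_diag_mx !mxE; congr (_ * _ - _).
  rewrite /degree -sum1dep_card natr_sum big_mkcond /=.
  by apply: eq_bigr => v _; case: (adj E u v).
by apply: eq_bigr => v _; rewrite mxE.
Qed.

Lemma spectrum_exists : is_spectrum L (xget [::] (is_spectrum L)).
Proof.
have [P [d [_ _ _ cL]]] := symmetric_spectral laplacian_sym.
apply: (@xgetPex _ [::] (is_spectrum L)).
exists (sort <=%R [seq d i | i <- enum 'I_n]); split.
  by apply: sort_sorted; apply: le_total.
rewrite cL (perm_big [seq d i | i <- enum 'I_n]) ?perm_sort//= big_map.
by rewrite big_enum.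
Qed.

(** Unique factorisation makes the sorted spectrum a permutation of [d]; [i0] indexes its first
    entry and [i1] its second, which differs from [i0] even for a multiple eigenvalue. *)
Lemma second_eigenvalue_rank (d : 'I_n -> R) : (1 < n)%N ->
  char_poly L = \prod_i ('X - (d i)%:P) ->
  exists i0 i1, [/\ i0 != i1, d i0 <= mu, d i1 = mu & forall i, i != i0 -> mu <= d i].
Proof.
move=> n1 cL; have [] := spectrum_exists; rewrite /second_eigenvalue.
set s := xget _ _ => so cs.
have ps : perm_eq s [seq d i | i <- enum 'I_n].
  by apply: prod_XsubC_eq; rewrite -cs cL big_map big_enum.
have sz : size s = n by rewrite (perm_size ps) size_map size_enum_ord.
case: s so ps sz {cs} => [|s0 [|m s]] so ps sz; rewrite -sz// in n1.
have /mapP[i0 _ e0] : s0 \in [seq d i | i <- enum 'I_n].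
  by rewrite -(perm_mem ps) mem_head.
have ps' : perm_eq (m :: s) [seq d i | i <- rem i0 (enum 'I_n)].
  rewrite -(perm_cons s0) (perm_trans ps)// {1}e0 -map_cons perm_map//.
  by rewrite perm_to_rem// mem_enum.
have /mapP[i1 i1r e1] : m \in [seq d i | i <- rem i0 (enum 'I_n)].
  by rewrite -(perm_mem ps') mem_head.
exists i0, i1; split => //=.
- by move: i1r; rewrite mem_rem_uniq ?enum_uniq// inE eq_sym => /andP[].
- by rewrite -e0; case/andP: so.
move=> i ii0; have : d i \in m :: s.
  by rewrite (perm_mem ps') map_f// mem_rem_uniq ?enum_uniq// inE ii0 mem_enum.
have : all (>= m) s by case/andP: so => _ /(order_path_min le_trans).
by move=> /allP h; rewrite inE => /orP[/eqP ->//|/h].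
Qed.

Lemma fiedler_exists : (1 < n)%N -> is_fiedler E (fiedler R E).
Proof.
move=> n1; have [P [d [_ _ _ cL]]] := symmetric_spectral laplacian_sym.
have [i0 [i1 [_ _ dmu _]]] := second_eigenvalue_rank n1 cL.
have : eigenvalue L mu.
  rewrite eigenvalue_root_char cL.
  have -> : \prod_i ('X - (d i)%:P) = \prod_(x <- [seq d i | i <- enum 'I_n]) ('X - x%:P).
    by rewrite big_map big_enum.
  by rewrite root_prod_XsubC -dmu map_f// mem_enum.
move=> /eigenvalueP[v vL v0].
(* [v] is a row eigenvector; symmetry turns its transpose into a column one. *)
apply: (@xgetPex _ 0 (is_fiedler E)); exists v^T; split; first by rewrite trmx_eq0.
by rewrite -[in LHS]laplacian_sym -trmx_mul vL linearZ.
Qed.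

Hypothesis cE : graph_connected [set: 'I_n]%SET E.

(** The energy is a nonpositive multiple of a sum of squares, whereas an edge along which [f]
    changes makes it positive. *)
Lemma lap_le0_const (f : 'I_n -> R) (a : R) : a <= 0 ->
  (forall u, lap E f u = a * f u) -> forall u v, f u = f v.
Proof.
move=> a0 Lf u v; apply/eqP/negPn/negP => nuv.
have [|x [y [_ xy /eqP fx fy]]] := @connect_cut _ _ [pred x | f x == f u] _ _
  (cE (finset.in_setT u) (finset.in_setT v)) (eqxx _).
  by rewrite inE eq_sym.
have : energy E f <= 0.
  rewrite energy_lap; under eq_bigr do rewrite Lf mulrCA -expr2.
  by rewrite -mulr_sumr mulr_ge0_le0// mulr_le0_ge0// sumr_ge0// => i _; apply: sqr_ge0.
rewrite leNgt /energy (bigD1 x)//= (bigD1 y)//= xy mul1r -addrA ltr_pwDl//.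
  by rewrite exprn_even_gt0//= subr_eq0 fx eq_sym.
by rewrite addr_ge0// sumr_ge0// => i _; rewrite ?sumr_ge0// => *; rewrite mulr_ge0// sqr_ge0.
Qed.

Local Notation "x %:C" := (real_complex R x).
Local Notation C := (R[i])%C.

Lemma lap_sum f u : lap E f u = \sum_k L u k * f k.
Proof.
have := laplacianE (\col_k f k) u; rewrite mxE.
have -> : lap E (fun v => (\col_k f k) v 0) u = lap E f u.
  by apply: eq_bigr => v _; rewrite !mxE.
by move=> <-; apply: eq_bigr => k _; rewrite !mxE.
Qed.

(** Otherwise the rows [i0] and [i1] of [P] would both be constant, which two orthonormal vectors
    cannot be. *)
Lemma second_eigenvalue_gt0 : (1 < n)%N -> 0 < mu.
Proof.
move=> n1; have [P [d [oP _ PL cL]]] := symmetric_spectral laplacian_sym.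
have [i0 [i1 [ne d0 d1 _]]] := second_eigenvalue_rank n1 cL.
rewrite ltNge; apply/negP => mu0.
have const i : d i <= 0 -> forall k l, P i k = P i l.
  move=> di k l.
  (* [h] stands for the real or the imaginary part, each of which is a real eigenfunction. *)
  have part (h : C -> R) : {morph h : x y / x + y} -> h 0 = 0 ->
      (forall z (x : R), h (z * x%:C) = h z * x) -> h (P i k) = h (P i l).
    move=> hD h0 hM; apply: (lap_le0_const (f := fun k => h (P i k)) di) => u.
    rewrite lap_sum mulrC -hM mulrC -PL (big_morph h hD h0); apply: eq_bigr => v _.
    by rewrite hM mulrC; have /matrixP/(_ u v) := laplacian_sym; rewrite [in X in X = _ -> _]mxE => ->.
  have eR : complex.Re (P i k) = complex.Re (P i l).
    by apply: part => [[? ?] [? ?]||[? ?] x] //=; rewrite mulr0 subr0.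
  have eI : complex.Im (P i k) = complex.Im (P i l).
    by apply: part => [[? ?] [? ?]||[? ?] x] //=; rewrite mulr0 add0r.
  by move: eR eI; case: (P i k) (P i l) => [a b] [a' b'] /= -> ->.
pose k0 : 'I_n := Ordinal (ltnW n1).
have inner i j : d i <= 0 -> d j <= 0 ->
    (P i k0 * (P j k0)^*) *+ n = (i == j)%:R.
  move=> di dj; rewrite -oP (eq_bigr (fun=> P i k0 * (P j k0)^*)).
    by rewrite sumr_const card_ord.
  by move=> k _; rewrite (const i di k k0) (const j dj k k0).
have d0' := le_trans d0 mu0; have d1' : d i1 <= 0 by rewrite d1.
have := inner _ _ d0' d1'; rewrite (negbTE ne) => /eqP.
have n0 : n != 0%N by rewrite -lt0n ltnW.
rewrite mulrn_eq0 (negbTE n0) /= mulf_eq0 conjC_eq0 => /orP[]/eqP P0.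
  by have := inner _ _ d0' d0'; rewrite P0 mul0r mul0rn eqxx => /eqP; rewrite eq_sym oner_eq0.
by have := inner _ _ d1' d1'; rewrite P0 mul0r mul0rn eqxx => /eqP; rewrite eq_sym oner_eq0.
Qed.

(** Expand [f] in the eigenbasis. The constants have only the coefficient [i0], so [f] has none
    there, and all other eigenvalues are at least [mu]. *)
Lemma second_eigenvalue_rayleigh (f : 'I_n -> R) : (1 < n)%N ->
  \sum_u f u = 0 -> 2 * mu * (\sum_u f u ^+ 2) <= energy E f.
Proof.
move=> n1 f0; have [P [d [_ oP PL cL]]] := symmetric_spectral laplacian_sym.
have [i0 [_ [_ _ _ dge]]] := second_eigenvalue_rank n1 cL.
have mu0 := second_eigenvalue_gt0 n1.
have cR (x : R) : (x%:C)^* = x%:C by apply/CrealP/complex_realP; exists x.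
pose y (g : 'I_n -> R) i := \sum_k P i k * (g k)%:C.
have parseval g h : \sum_i (y g i)^* * y h i = (\sum_k g k * h k)%:C.
  under eq_bigr do rewrite rmorph_sum /= mulr_suml.
  rewrite exchange_big rmorph_sum /=; apply: eq_bigr => k _.
  under eq_bigr do rewrite mulr_sumr.
  rewrite exchange_big /= (bigD1 k)//= [X in _ + X]big1 => [|l lk].
    under eq_bigr do rewrite rmorphM /= cR mulrACA.
    by rewrite -mulr_suml oP eqxx mul1r addr0 rmorphM.
  under eq_bigr do rewrite rmorphM /= cR mulrACA.
  by rewrite -mulr_suml oP eq_sym (negbTE lk) mul0r.
have ylap g i : y (lap E g) i = (d i)%:C * y g i.
  rewrite /y mulr_sumr; under eq_bigr do rewrite lap_sum rmorph_sum /= mulr_sumr.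
  rewrite exchange_big /=; apply: eq_bigr => l _.
  by rewrite mulrA -PL mulr_suml; apply: eq_bigr => k _; rewrite rmorphM mulrA.
pose one : 'I_n -> R := fun=> 1.
(* The Laplacian kills constants, while [d i >= mu > 0]. *)
have y1 i : i != i0 -> y one i = 0.
  move=> ii0; have := ylap one i.
  have -> : y (lap E one) i = 0.
    rewrite /y big1// => k _; rewrite (_ : lap E one k = 0) ?rmorph0 ?mulr0//.
    by rewrite /lap big1// => v _; rewrite subrr mulr0.
  move=> /esym/eqP; rewrite mulf_eq0 => /orP[/eqP/complexI di|/eqP//].
  by have := lt_le_trans mu0 (dge i ii0); rewrite di ltxx.
have yf : y f i0 = 0.
  have := parseval one one; rewrite (bigD1 i0)//= [X in _ + X]big1 ?addr0; last first.
    by move=> i /y1 ->; rewrite mulr0.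
  under eq_bigr do rewrite mulr1; rewrite sumr_const card_ord => y11.
  have y1n0 : y one i0 != 0.
    apply/eqP => y10; move: y11; rewrite y10 mulr0 => /esym/eqP.
    by rewrite -[0]/(0%:C) (inj_eq (@complexI R)) pnatr_eq0 -leqn0 leqNgt (ltnW n1).
  have := parseval f one; rewrite (bigD1 i0)//= [X in _ + X]big1 ?addr0; last first.
    by move=> i /y1 ->; rewrite mulr0.
  under eq_bigr do rewrite mulr1; rewrite f0 rmorph0 => /eqP.
  by rewrite mulf_eq0 (negbTE y1n0) orbF conjC_eq0 => /eqP.
have -> : \sum_u f u ^+ 2 = \sum_u f u * f u by apply: eq_bigr => u _; rewrite expr2.
rewrite energy_lap -mulrA ler_pM2l// -lecR rmorphM /= -!parseval.
rewrite mulr_sumr; apply: ler_sum => i _; rewrite ylap.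
have [->|ii0] := eqVneq i i0; first by rewrite yf !mulr0.
rewrite [leRHS]mulrCA ler_wpM2r ?lecR ?dge// mulrC mul_conjC_ge0//.
Qed.

End LaplacianSpectrum.

(** * The upper bound *)

Section CharSet.
Variables (R : realType) (n : nat) (E : {set {set 'I_n}}).
Hypothesis (n1 : (1 < n)%N) (tE : is_tree [set: 'I_n]%SET E).

Let cE : graph_connected [set: 'I_n]%SET E.
Proof. by case: tE. Qed.

Lemma lap_fiedler u :
  lap E (fun v => fiedler R E v 0) u = second_eigenvalue R E * fiedler R E u 0.
Proof. by have [_ LY] := fiedler_exists R E n1; rewrite -laplacianE LY mxE. Qed.

Lemma char_set_eccentricity c p : c \in char_set R E ->
  path (adj E) c p -> uniq (c :: p) -> (2 * size p <= n.+1)%N.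
Proof.
move=> cC pE up; rewrite -[n in leqRHS]card_ord.
apply: (char_eccentricity tE (second_eigenvalue_gt0 R cE n1)
  (fun f => @second_eigenvalue_rayleigh R n E cE f n1) lap_fiedler pE up).
move: cC; rewrite /char_set inE => /orP[|/bigcupP[D]].
  rewrite inE => /andP[/eqP Yc /existsP[x /andP[cx Yx]]].
  by left; split => //; exists x.
rewrite inE => /andP[DE /existsP[u /existsP[v /andP[/eqP De Yuv]]]].
rewrite De in DE *; rewrite !inE => /orP[]/eqP ->; right.
  by exists v.
by exists u; [rewrite adj_sym|rewrite mulrC].
Qed.

(** A Fiedler vector is nonzero with sum zero, so it takes both signs. Some edge leads from a
    positive to a nonpositive value: a zero gives a characteristic vertex, a negative value a
    characteristic edge. *)
Lemma char_set_neq0 : exists c, c \in char_set R E.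
Proof.
pose Y v := fiedler R E v 0.
have [Y0 _] := fiedler_exists R E n1.
have mu0 := second_eigenvalue_gt0 R cE n1.
have SY : \sum_u Y u = 0.
  have h : \sum_u lap E Y u = 0.
    have e : \sum_u lap E Y u = - \sum_u lap E Y u.
      rewrite [LHS]exchange_big -sumrN; apply: eq_bigr => u _ /=.
      by rewrite -sumrN; apply: eq_bigr => v _; rewrite (adj_sym E v u) -mulrN opprB.
    lra.
  move: h; rewrite (eq_bigr _ (fun u _ => lap_fiedler u)) -mulr_sumr => /eqP.
  by rewrite mulf_eq0 (gt_eqF mu0) => /eqP.
have pos (f : 'I_n -> R) : \sum_u f u = 0 -> (exists x, f x != 0) -> exists x, 0 < f x.
  move=> f0 [x fx]; apply/not_existsP => h.
  have Nf0 : \sum_u - f u = 0 by rewrite sumrN f0 oppr0.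
  move: fx; rewrite -oppr_eq0 (psumr_eq0P _ Nf0) ?eqxx// => u _.
  by rewrite oppr_ge0 leNgt; apply/negP/h.
have [x0 Yx0] : exists x, Y x != 0.
  apply/not_existsP => h; move/eqP: Y0; apply; apply/matrixP => i j.
  by rewrite ord1 mxE; apply/eqP/negPn/negP/h.
have [u Yu] : exists u, 0 < Y u by apply: pos => //; exists x0.
have [v Yv] : exists v, 0 < - Y v.
  by apply: (pos (fun v => - Y v)); [rewrite sumrN SY oppr0|exists x0; rewrite oppr_eq0].
have [|x [y [_ xy Yx Yy]]] := @connect_cut _ _ [pred x | 0 < Y x] _ _
  (cE (finset.in_setT u) (finset.in_setT v)) Yu.
  by rewrite inE -leNgt ltW// -oppr_gt0.
rewrite !inE -leNgt in Yx Yy; move: Yy; rewrite le_eqVlt => /orP[Yy|Yy].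
  exists y; rewrite !inE; apply/orP; left; rewrite Yy /=; apply/existsP; exists x.
  by rewrite adj_sym xy /= gt_eqF.
exists x; rewrite inE; apply/orP; right; apply/bigcupP; exists [set x; y]%SET; last first.
  by rewrite !inE eqxx.
rewrite inE; apply/andP; split; first exact: xy.
apply/existsP; exists x; apply/existsP; exists y.
by rewrite eqxx /= pmulr_rlt0.
Qed.

End CharSet.

(** * Distances between vertex sets *)

Section Distances.
Variable T : finType.
Implicit Types (E : {set {set T}}) (A B : {set T}).

Lemma dist_path E u v : is_tree [set: T]%SET E ->
  exists2 p, is_path E u v p & dist E u v = size p.
Proof.
case=> _ _ cE _; exists (xget [::] (is_path E u v)) => //.
apply: (@xgetPex _ [::] (is_path E u v)).
have /connectP[p pp ->] := cE u v (finset.in_setT _) (finset.in_setT _).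
by case: (shortenP pp) => q qE uq _; exists q.
Qed.

Lemma big_minn_le (I : eqType) (r : seq I) (P : pred I) (F : I -> nat) N i :
  i \in r -> P i -> (\big[minn/N]_(j <- r | P j) F j <= F i)%N.
Proof.
elim: r => [|j r IH]//; rewrite inE big_cons => /orP[/eqP <- ->|ir Pi].
  exact: geq_minl.
case: ifP => _; last exact: IH.
by apply: leq_trans (IH ir Pi); exact: geq_minr.
Qed.

Lemma big_minn_ge (I : Type) (r : seq I) (P : pred I) (F : I -> nat) N b :
  (b <= N)%N -> (forall i, P i -> b <= F i)%N -> (b <= \big[minn/N]_(j <- r | P j) F j)%N.
Proof.
by move=> bN bF; elim/big_ind: _ => // x y bx bby; rewrite leq_min bx.
Qed.

Lemma dist_sets_le E A B u v : u \in A -> v \in B -> (dist_sets E A B <= dist E u v)%N.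
Proof.
move=> uA vB; rewrite /dist_sets.
apply: leq_trans (big_minn_le _ _ (mem_index_enum u) uA) _.
exact: big_minn_le (mem_index_enum v) vB.
Qed.

(** The bound on [b] covers the seed of the minimum. *)
Lemma dist_sets_ge E A B b : (b <= #|T|)%N ->
  (forall u v, u \in A -> v \in B -> b <= dist E u v)%N -> (b <= dist_sets E A B)%N.
Proof.
by move=> bT h; apply: big_minn_ge => // u uA; apply: big_minn_ge => // v; apply: h.
Qed.

Lemma subtree_core_neq0 E (x : T) : exists v, v \in subtree_core E.
Proof.
have [v _ h] := @arg_maxnP _ x xpredT (num_subtrees E) isT.
by exists v; rewrite inE; apply/forallP => u; apply: h.
Qed.

End Distances.

Lemma delta_upper (R : realType) n : (1 < n)%N -> (2 * delta R n <= n.+1)%N.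
Proof.
move=> n1; rewrite mul2n -geq_half_double.
apply/bigmax_leqP => E /asboolP tE.
have [c cC] := char_set_neq0 R n1 tE.
have [v vS] := subtree_core_neq0 E c.
apply: leq_trans (dist_sets_le E cC vS) _.
have [p [pp _ up] ->] := dist_path c v tE.
rewrite geq_half_double -mul2n.
by have h := char_set_eccentricity n1 tE cC pp up; exact h.
Qed.

(** * Brooms *)

Section Broom.
Variables (a k : nat).
Local Notation n := (a.+1 + k)%N.
Implicit Types (u v x y : 'I_n) (S : {set 'I_n} * {set {set 'I_n}}).

(* The path 0, 1, ..., a with k further leaves a + 1, ..., a + k attached to a:
   the parent of v > 0 is min (v - 1, a). *)
Definition broom : {set {set 'I_n}} :=
  [set D | [exists u : 'I_n, exists v : 'I_n,
     [&& D == [set u; v]%SET, (0 < u)%N & (v == minn u.-1 a :> nat)]]]%SET.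

Lemma broomP (D : {set 'I_n}) : reflect
  (exists u v, [/\ D = [set u; v]%SET, (0 < u)%N & v = minn u.-1 a :> nat])
  (D \in broom).
Proof.
rewrite inE; apply: (iffP existsP) => [[u /existsP[v /and3P[/eqP ? ? /eqP ?]]]|].
  by exists u, v.
by move=> [u [v [-> u0 uv]]]; exists u; apply/existsP; exists v; rewrite eqxx u0 uv eqxx.
Qed.

Lemma set2_eq (T : finType) (u v x y : T) : x != y ->
  [set u; v]%SET = [set x; y]%SET -> (u = x /\ v = y) \/ (u = y /\ v = x).
Proof.
move=> xy e.
have : u \in [set x; y]%SET by rewrite -e !inE eqxx.
have : v \in [set x; y]%SET by rewrite -e !inE eqxx orbT.
have : x \in [set u; v]%SET by rewrite e !inE eqxx.
have : y \in [set u; v]%SET by rewrite e !inE eqxx orbT.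
rewrite !inE => h1 h2 /orP[]/eqP ev /orP[]/eqP eu; subst; rewrite ?eqxx in xy *; auto.
  by rewrite orbb eq_sym (negbTE xy) in h1.
by rewrite orbb (negbTE xy) in h2.
Qed.

Lemma adj_broom u v : adj broom u v =
  ((0 < u)%N && (v == minn u.-1 a :> nat)) || ((0 < v)%N && (u == minn v.-1 a :> nat)).
Proof.
apply/broomP/orP => [[x [y [e x0 yx]]]|].
  have xy : x != y by apply/eqP => h; have := congr1 val h => /=; lia.
  by case: (set2_eq xy e) => -[-> ->]; [left|right]; rewrite x0 yx eqxx.
move=> [/andP[u0 /eqP h]|/andP[v0 /eqP h]]; first by exists u, v.
by exists v, u; rewrite finset.setUC.
Qed.

Lemma adj_broom_lt u v : (v < u)%N -> adj broom u v = (v == minn u.-1 a :> nat).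
Proof. by move=> vu; rewrite adj_broom; lia. Qed.

(** Following parents leads to 0. The largest vertex of a cycle would have two distinct smaller
    neighbours, but its parent is the only one. *)
Lemma broom_tree : is_tree [set: 'I_n]%SET broom.
Proof.
have o0 : (0 < n)%N by lia.
split.
- by apply/set0Pn; exists (Ordinal o0); rewrite inE.
- move=> D /broomP[u [v [-> u0 vu]]]; split; last exact: finset.subsetT.
  by rewrite cards2 (_ : u != v)//; apply/eqP => h; have := congr1 val h => /=; lia.
- have c0 u : connect (adj broom) u (Ordinal o0).
    have [m] := ubnP (val u); elim: m u => // m IH u um.
    have [u0|u0] := posnP (val u).
      by rewrite (_ : u = Ordinal o0)//; apply: val_inj.
    have pn : (minn u.-1 a < n)%N by have := ltn_ord u; lia.
    apply: (connect_trans (y := Ordinal pn)); first by apply: connect1; rewrite adj_broom u0 eqxx.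
    by apply: IH => /=; move: um u0 => /=; lia.
  move=> u v _ _; apply: connect_trans (c0 u) _.
  by rewrite (sym_connect_sym (adj_sym _)).
move=> c; rewrite leqNgt; case/andP => cc uc; apply/negP => sc.
have [x xc xmax] : exists2 x, x \in c & forall y, y \in c -> (y <= x)%N.
  case: c sc {cc uc} => // z c _.
  have [x xc h] := @arg_maxnP _ z (mem (z :: c)) val (mem_head _ _).
  by exists x.
have [i c' ec] := rot_to xc.
have : cycle (adj broom) (x :: c') by rewrite -ec rot_cycle.
have : uniq (x :: c') by rewrite -ec rot_uniq.
have : (2 < size (x :: c'))%N by rewrite -ec size_rot.
have {}xmax y : y \in x :: c' -> (y <= x)%N by rewrite -ec mem_rot; apply: xmax.
case/lastP: c' {ec} xmax => // -[|y c'] z xmax // _ ux /=.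
rewrite rcons_path last_rcons => /andP[xy /andP[_ zx]].
have lt t : t \in rcons (y :: c') z -> (t < x)%N.
  move=> tc; rewrite ltn_neqAle; apply/andP; split; last first.
    by apply: xmax; rewrite in_cons tc orbT.
  by apply: contraTneq tc => /val_inj ->; case/andP: ux.
have ey : y = minn x.-1 a :> nat.
  by apply/eqP; rewrite -adj_broom_lt// lt// mem_rcons !inE eqxx orbT.
have ez : z = minn x.-1 a :> nat.
  by apply/eqP; rewrite -adj_broom_lt 1?adj_sym// lt// mem_rcons !inE eqxx.
have yz : y = z by apply: val_inj; rewrite /= ey ez.
by case/and3P: ux => _; rewrite yz mem_rcons inE eqxx.
Qed.

(** The height [minn u a] changes by at most 1 along an edge. *)
Lemma broom_path_height u (p : seq 'I_n) : path (adj broom) u p ->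
  (minn u a <= minn (last u p) a + size p)%N /\
  (minn (last u p) a <= minn u a + size p)%N.
Proof.
elim: p u => [|v p IH] u /=; first by rewrite addn0.
move=> /andP[+ /IH{IH}[h1 h2]]; rewrite adj_broom; move: (last v p : 'I_n) h1 h2 => t h1 h2.
by case/orP => /andP[u0 /eqP e]; split; lia.
Qed.

Let a0 : 'I_n := lshift k ord_max.

(** * Counting subtrees of a broom *)

Section SubtreesAvoidingCenter.
Variable v : 'I_n.
Hypothesis va : (v < a)%N.

Let Sv := [set S in subtrees broom | v \in S.1]%SET.
Let Sa := [set S in subtrees broom | a0 \in S.1]%SET.

(** A subtree passing from below [a] to [a] or beyond must do so through the vertex [a0]. *)
Lemma avoid_lt S x : S \in Sv :\: Sa -> x \in S.1 -> (x < a)%N.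
Proof.
rewrite !inE => /andP[h1 /andP[/andP[sE /asboolP tS] vS]] xS.
move: h1; rewrite sE asboolT//= => a0S.
rewrite ltnNge; apply/negP => ax; case: tS => _ gS cS _.
have [||x' [y [_ xy xA yA]]] := @connect_cut _ _ [pred t : 'I_n | (t < a)%N] _ _ (cS v x vS xS).
- by rewrite inE.
- by rewrite inE -leqNgt.
rewrite !inE in xA yA.
have : adj broom x' y by move/fintype.subsetP: sE; apply.
rewrite adj_sym adj_broom_lt; last lia.
move=> e; have ya : y = a0 by apply: val_inj => /=; lia.
by have := adj_in gS xy; rewrite ya (negbTE a0S) andbF.
Qed.

Lemma avoid_edge S x y (i j : 'I_n) : S \in Sv :\: Sa -> x \in S.1 -> y \in S.1 ->
  (x <= i < y)%N -> j = i.+1 :> nat -> adj S.2 i j.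
Proof.
move=> hS xS yS xiy ji; have lta := avoid_lt hS.
move: hS; rewrite !inE => /andP[_ /andP[/andP[sE /asboolP[_ gS cS _]] _]].
have [||x' [y' [_ xy xA yA]]] := @connect_cut _ _ [pred t : 'I_n | (t <= i)%N] _ _ (cS x y xS yS).
- by rewrite inE; lia.
- by rewrite inE -ltnNge; lia.
rewrite !inE -ltnNge in xA yA.
have : adj broom x' y' by move/fintype.subsetP: sE; apply.
have /andP[_ /lta ya] := adj_in gS xy.
rewrite adj_sym adj_broom_lt; last lia.
move=> e; have -> : i = x' by apply: val_inj => /=; lia.
by have -> : j = y' by apply: val_inj => /=; lia.
Qed.

Lemma avoid_sub S S' l h : S \in Sv :\: Sa -> S' \in Sv :\: Sa ->
  l \in S'.1 -> h \in S'.1 -> (forall x, x \in S.1 -> (l <= x <= h)%N) ->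
  (S.1 \subset S'.1) && (S.2 \subset S'.2).
Proof.
move=> hS hS' lS' hS'' lh; apply/andP.
have gS' : is_graph S'.1 S'.2.
  by move: hS'; rewrite !inE => /andP[_ /andP[/andP[_ /asboolP[]]]].
split; apply/fintype.subsetP.
  move=> x xS; have [->//|xh] := eqVneq x h.
  have {}xh : (x < h)%N by have := lh x xS; rewrite ltn_neqAle => /andP[_ ->]; rewrite xh.
  have x1 : (x.+1 < n)%N by have := ltn_ord h; lia.
  have e : adj S'.2 x (Ordinal x1) by apply: (avoid_edge hS' lS' hS'') => //; have := lh x xS; lia.
  by have /andP[] := adj_in gS' e.
move=> D DS; have lta := avoid_lt hS.
move: hS; rewrite !inE => /andP[_ /andP[/andP[sE /asboolP[_ gS _ _]] _]].
have /broomP[u [t [De u0 tu]]] : D \in broom by move/fintype.subsetP: sE; apply.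
have /andP[uS tS] : (u \in S.1) && (t \in S.1) by apply: (adj_in gS); rewrite /adj -De.
have ua := lta u uS; have h1 := lh u uS; have h2 := lh t tS.
have : adj S'.2 t u by apply: (avoid_edge hS' lS' hS''); lia.
by rewrite adj_sym /adj -De.
Qed.

(** These subtrees are intervals of the path, determined by their least and greatest vertices. *)
Lemma card_avoid : (#|Sv :\: Sa| <= n * n)%N.
Proof.
pose lo S := [arg min_(i < v in S.1) val i]%N.
pose hi S := [arg max_(i > v in S.1) val i]%N.
have loP S : S \in Sv :\: Sa -> lo S \in S.1 /\ forall x, x \in S.1 -> (lo S <= x)%N.
  rewrite !inE => /andP[_ /andP[_ vS]]; rewrite /lo.
  by case: arg_minnP => // i iS im; split.
have hiP S : S \in Sv :\: Sa -> hi S \in S.1 /\ forall x, x \in S.1 -> (x <= hi S)%N.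
  rewrite !inE => /andP[_ /andP[_ vS]]; rewrite /hi.
  by case: arg_maxnP => // i iS im; split.
have inj : {in Sv :\: Sa &, injective (fun S => (lo S, hi S))}.
  move=> S S' hS hS' [elo ehi].
  have [l1 l2] := loP S hS; have [h1 h2] := hiP S hS.
  have [l1' l2'] := loP S' hS'; have [h1' h2'] := hiP S' hS'.
  have /andP[s1 s2] : (S.1 \subset S'.1) && (S.2 \subset S'.2).
    by apply: avoid_sub hS hS' l1' h1' _ => x xS; rewrite -elo -ehi l2 ?h2.
  have /andP[s1' s2'] : (S'.1 \subset S.1) && (S'.2 \subset S.2).
    by apply: avoid_sub hS' hS l1 h1 _ => x xS; rewrite elo ehi l2' ?h2'.
  case: S S' s1 s2 s1' s2' {hS hS' elo ehi l1 l2 h1 h2 l1' l2' h1' h2'} => [V F] [V' F'] /= *.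
  by congr pair; apply/eqP; rewrite finset.eqEsubset; apply/andP.
rewrite -(card_in_imset inj) (leq_trans (max_card _))// card_prod !card_ord//.
Qed.

(** Each set of leaves spans with [a0] a star, which misses [v] because [v < a]. *)
Lemma card_star : (2 ^ k <= #|Sa :\: Sv|)%N.
Proof.
pose star (A : {set 'I_k}) : {set 'I_n} * {set {set 'I_n}} :=
  (a0 |: [set rshift a.+1 x | x in A], [set [set a0; rshift a.+1 x] | x in A])%SET.
have a0r (x : 'I_k) : rshift a.+1 x != a0 by apply/eqP => h; have := congr1 val h => /=; lia.
have inj : injective star.
  move=> A A' [eV _]; apply/setP => x.
  have := congr1 (fun V : {set 'I_n} => rshift a.+1 x \in V) eV.
  by rewrite !inE (negbTE (a0r x)) /= !mem_imset//; apply: rshift_inj.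
have sub : [set star A | A in [set: {set 'I_k}]]%SET \subset Sa :\: Sv.
  apply/fintype.subsetP => S /imsetP[A _ ->].
  have sE : (star A).2 \subset broom.
    apply/fintype.subsetP => D /imsetP[x _ ->].
    by change (adj broom a0 (rshift a.+1 x)); rewrite adj_sym adj_broom_lt /=; lia.
  have tS : is_tree (star A).1 (star A).2.
    split.
    - by apply/set0Pn; exists a0; rewrite !inE eqxx.
    - move=> D /imsetP[x xA ->]; split; first by rewrite cards2 eq_sym a0r.
      apply/fintype.subsetP => y; rewrite !inE => /orP[->//|/eqP ->].
      by rewrite imset_f ?orbT.
    - have c0 u : u \in (star A).1 -> connect (adj (star A).2) a0 u.
        rewrite !inE => /orP[/eqP ->//|/imsetP[x xA ->]].
        by apply: connect1; apply: imset_f.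
      move=> u w /c0 uA /c0 wA; apply: connect_trans wA.
      by rewrite (sym_connect_sym (adj_sym _)).
    by apply: acyclic_sub sE _; case: broom_tree.
  have vS : v \notin (star A).1.
    rewrite !inE negb_or; apply/andP; split.
      by apply/eqP => h; have := congr1 val h => /=; lia.
    by apply/imsetP => -[x _ h]; have := congr1 val h => /=; lia.
  apply/finset.setDP; split; last by rewrite inE negb_and vS orbT.
  rewrite inE; apply/andP; split; last by rewrite !inE eqxx.
  by rewrite inE sE; apply/asboolP.
rewrite (leq_trans _ (subset_leq_card sub))// card_imset//.
by rewrite -powersetT card_powerset cardsT card_ord.
Qed.

Lemma broom_num_subtrees_lt : (n * n < 2 ^ k)%N ->
  (num_subtrees broom v < num_subtrees broom a0)%N.
Proof.
move=> nk; rewrite /num_subtrees -/Sv -/Sa.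
rewrite -(cardsID Sa Sv) -(cardsID Sv Sa) (finset.setIC Sa) ltn_add2l.
exact: leq_ltn_trans card_avoid (leq_trans nk card_star).
Qed.

End SubtreesAvoidingCenter.

Lemma broom_core v : (n * n < 2 ^ k)%N -> v \in subtree_core broom -> (a <= v)%N.
Proof.
move=> nk; rewrite inE => /forallP/(_ a0); apply: contraTT; rewrite -!ltnNge => va.
exact: broom_num_subtrees_lt.
Qed.

(** Characteristic vertices are within [(n + 1) / 2] of vertex 0, hence have at most that height,
    while the core has height [a]. *)
Lemma delta_lower (R : realType) : (1 < n)%N -> (n * n < 2 ^ k)%N ->
  (2 * a <= 2 * delta R n + n.+1)%N.
Proof.
move=> n1 nk; have tB := broom_tree.
have le : (dist_sets broom (char_set R broom) (subtree_core broom) <= delta R n)%N.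
  by apply: leq_bigmax_cond; apply/asboolP.
suff : (a - n.+1./2 <= dist_sets broom (char_set R broom) (subtree_core broom))%N by lia.
apply: dist_sets_ge; first by rewrite card_ord; lia.
move=> c v cC /(broom_core nk) av.
have o0 : (0 < n)%N by lia.
have [p [pp lp up] _] := dist_path c (Ordinal o0) tB.
have h0 := char_set_eccentricity n1 tB cC pp up.
have [h1 _] := broom_path_height pp; rewrite lp /= in h1.
have [q [qp lq _] ->] := dist_path c v tB.
have [_ h2] := broom_path_height qp; rewrite lq in h2.
have key (s t x y : nat) : (2 * s <= n.+1)%N -> (minn x a <= minn 0 a + s)%N ->
    (minn y a <= minn x a + t)%N -> (a <= y)%N -> (a - n.+1./2 <= t)%N.
  by clear; lia.
exact (key _ _ _ _ h0 h1 h2 av).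
Qed.

End Broom.

(** * Logarithmic error term and the limit *)

Lemma sqr_le_exp2 t : (t * t <= 2 * 2 ^ t)%N.
Proof.
have [|t4] := ltnP t 4; first by case: t => [|[|[|[|]]]].
suff : (t * t <= 2 ^ t)%N by lia.
elim: t t4 => // t IH; rewrite leq_eqVlt => /orP[/eqP <-//|t4].
by have := IH t4; rewrite expnS; nia.
Qed.

Lemma delta_lower_log (R : realType) n : (1 < n)%N ->
  (n <= 2 * delta R n + (4 * trunc_log 2 n + 7))%N.
Proof.
move=> n1; set t := trunc_log 2 n.
have nt : (n < 2 ^ t.+1)%N by apply: trunc_log_ltn.
(* Just enough leaves for [n * n < 2 ^ k]; with [a = n - 1 - k] the error in [delta_lower] becomes
   [2 * k + 3 = 4 * t + 7]. *)
pose k := (t.+1 + t.+1)%N.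
have nk : (n * n < 2 ^ k)%N by rewrite expnD ltn_mul.
have [kn|] := ltnP k n; last by rewrite /k; lia.
have en : n = ((n.-1 - k).+1 + k)%N by lia.
have := @delta_lower (n.-1 - k) k R; rewrite -en => /(_ n1 nk).
by rewrite /k in kn *; lia.
Qed.

Local Open Scope classical_set_scope.
Local Open Scope ring_scope.

Theorem theorem3p11 (R : realType) :
  ((delta R n)%:R / n%:R : R) @[n --> \oo] --> (1 / 2 : R).
Proof.
apply/cvgrPdist_lt => e e0; near=> n.
have n1 : (1 < n)%N by near: n; exact: nbhs_infty_gt.
have ne : 162 / e ^+ 2 < n%:R by near: n; exact: nbhs_infty_gtr.
have up := delta_upper R n1; have lo := delta_lower_log R n1.
set t := trunc_log 2 n in lo.
(* As [t ^ 2 <= 2 * n] and [7 ^ 2 <= 25 * (2 * n)], the sum [4 * t + 7] is at most 9 times the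
   square root of [2 * n], and [162 = 2 * 9 ^ 2]. *)
have tn : ((4 * t + 7) * (4 * t + 7) <= 162 * n)%N.
  have := sqr_le_exp2 t; have := @trunc_logP 2 n isT (ltnW n1); rewrite -/t; nia.
have n0 : 0 < n%:R :> R by rewrite ltr0n ltnW.
have te : (4 * t + 7)%:R < e * n%:R :> R.
  rewrite -(ltr_pXn2r (n := 2)) ?nnegrE ?mulr_ge0 ?ltW//.
  have h : (4 * t + 7)%:R ^+ 2 <= 162 * n%:R :> R by rewrite expr2 -!natrM ler_nat.
  apply: le_lt_trans h _; rewrite exprMn expr2 [n%:R ^+ 2]expr2 mulrA ltr_pM2r//.
  by rewrite -expr2 mulrC -ltr_pdivrMr ?exprn_gt0.
have up' : 2 * (delta R n)%:R <= n%:R + 1 :> R by rewrite -natrM natr1 ler_nat.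
have lo' : n%:R <= 2 * (delta R n)%:R + (4 * t + 7)%:R :> R.
  by rewrite -natrM -natrD ler_nat.
(* Absorbs the additive 1 of the upper bound into the same error term. *)
have t1 : 1 <= (4 * t + 7)%:R :> R by rewrite ler1n addnC.
have -> : 1 / 2 - (delta R n)%:R / n%:R = (n%:R / 2 - (delta R n)%:R) / n%:R :> R.
  by rewrite mulrBl mulrAC divff ?gt_eqF.
rewrite normrM normfV (gtr0_norm n0) ltr_pdivrMr// ltr_norml.
by apply/andP; split; lra.
Unshelve. all: by end_near.
Qed.
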